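(* The linearization map $\mathsf{L}$, from the set of crooked halfspaces of $\mathsf{E}$ to the set of halfplanes of $\mathsf{H}^2$, preserves the partial ordering defined by inclusion and the involution defined by complement. That is: (i) if $\mathcal{H}_1,\mathcal{H}_2\subset\mathsf{E}$ are crooked halfspaces with $\mathcal{H}_1\subset\mathcal{H}_2$, then $\mathsf{L}(\mathcal{H}_1)\subset\mathsf{L}(\mathcal{H}_2)$; (ii) if $\mathcal{H}\subset\mathsf{E}$ is a crooked halfspace, then the complementary set $\mathsf{E}\setminus\overline{\mathcal{H}}$ (with $\overline{\mathcal{H}}$ the closure of $\mathcal{H}$) is a crooked halfspace, and $\mathsf{L}(\mathsf{E}\setminus\overline{\mathcal{H}})$ is the halfplane of $\mathsf{H}^2$ complementary to $\mathsf{L}(\mathcal{H})$.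
   Context: $\mathsf{V}$ is an oriented real $3$-dimensional vector space with an inner product $\mathbf{u}\cdot\mathbf{v}$ of signature $(2,1)$ and a chosen time-orientation: one of the two components of the set of timelike vectors ($\mathbf{v}\cdot\mathbf{v}<0$) is selected and called $\mathsf{Future}$. A nonzero non-spacelike vector is future-pointing if it lies in the closure of $\mathsf{Future}$. $\mathsf{E}$ (Minkowski space) is an affine space with group of translations $\mathsf{V}$. A vector $\mathbf{s}$ is unit-spacelike if $\mathbf{s}\cdot\mathbf{s}=1$. For such $\mathbf{s}$, $\mathbf{s}^-,\mathbf{s}^+\in\mathbf{s}^\perp$ denote future-pointing null vectors with $\mathbf{s}^-\cdot\mathbf{s}^+=-1$ such that $(\mathbf{s},\mathbf{s}^-,\mathbf{s}^+)$ is a positively oriented basis of $\mathsf{V}$ (they are unique up to $(\mathbf{s}^-,\mathbf{s}^+)\mapsto(\lambda\mathbf{s}^-,\lambda^{-1}\mathbf{s}^+)$, $\lambda>0$, and nothing below depends on this choice). For $p\in\mathsf{E}$ and $\mathbf{s}$ unit-spacelike, the (open) crooked halfspace with vertex $p$ and director $\mathbf{s}$ is $$\mathcal{H}(p,\mathbf{s})=\{q: (q-p)\cdot\mathbf{s}^+<0,\ (q-p)\cdot\mathbf{s}>0\}\cup\{q:(q-p)\cdot\mathbf{s}^+<0,\ (q-p)\cdot\mathbf{s}^->0,\ (q-p)\cdot\mathbf{s}=0\}\cup\{q:(q-p)\cdot\mathbf{s}^->0,\ (q-p)\cdot\mathbf{s}<0\}.$$ A crooked halfspace is a set of this form; it determines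 $p$ and $\mathbf{s}$. The hyperbolic plane is $\mathsf{H}^2=\{\mathbf{v}\in\mathsf{Future}:\mathbf{v}\cdot\mathbf{v}=-1\}$. A halfplane of $\mathsf{H}^2$ is a set $\mathfrak{h}(\mathbf{s})=\{\mathbf{v}\in\mathsf{H}^2:\mathbf{v}\cdot\mathbf{s}\ge 0\}$ with $\mathbf{s}$ spacelike; it is bounded by the geodesic $\mathsf{H}^2\cap\mathbf{s}^\perp$. The halfplane complementary to a halfplane $\mathfrak{h}$ is the other halfplane bounded by the same geodesic, i.e. the closure of $\mathsf{H}^2\setminus\mathfrak{h}$. The linearization of $\mathcal{H}(p,\mathbf{s})$ is $\mathsf{L}(\mathcal{H}(p,\mathbf{s}))=\mathfrak{h}(\mathbf{s})$. *)

(* Defs.v *)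
From HB Require Import structures.
From mathcomp Require Import all_boot all_order all_algebra.
From mathcomp Require Import all_classical all_reals all_analysis.

Set Implicit Arguments.
Unset Strict Implicit.
Unset Printing Implicit Defensive.

Import Order.TTheory GRing.Theory Num.Theory.
Import numFieldNormedType.Exports.

Local Open Scope classical_set_scope.
Local Open Scope ring_scope.

(** ** The usual topology of a finite-dimensional real vector space *)

(* The initial topology of the coordinate isomorphism V -> R^n given by a
   basis; it does not depend on the basis. *)
Definition chart (R : realType) (V : vectType R) : V -> 'rV[R]_(\dim {:V}) :=
  passmx.rVof (vbasis {:V}).

Definition vtop (R : realType) (V : vectType R) : topologicalType :=
  initial_topology (@chart R V).

(** ** The vector space V *)

Section Vectors.
Context (R : realType) (V : vectType R).

Definition signature21 (f : {symmetric V}) : Prop :=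
  exists2 e : 3.-tuple V, basis_of {:V} e &
    forall i j : 'I_3, f (tnth e i) (tnth e j) =
      if i == j then (if i == ord_max then -1 else 1) else 0.

(* A basis is positively oriented when its matrix in the reference basis e0
   has positive determinant. A triple satisfying the condition below is
   automatically a basis. *)
Definition same_orientation (e0 e : 3.-tuple V) : Prop :=
  0 < \det (\matrix_(i < 3, j < 3) coord e0 j (tnth e i)).

Definition timelike_set (f : {symmetric V}) : set V := [set v | f v v < 0].

Record minkowski_structure := MinkowskiStructure {
  dot : {symmetric V};
  dot_signature : signature21 dot;
  (* a basis representing the orientation *)
  oriented_basis : 3.-tuple V;
  oriented_basisP : basis_of {:V} oriented_basis;
  Future : set V;
  Future_component : exists2 v, timelike_set dot v &
    Future = connected_component (timelike_set dot : set (vtop V)) v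
}.

Context (M : minkowski_structure).

Definition vclosure (A : set V) : set V := closure (A : set (vtop V)).

Definition positive_basis (e : 3.-tuple V) : Prop :=
  same_orientation (oriented_basis M) e.

Definition null (v : V) : Prop := v != 0 /\ dot M v v = 0.

Definition spacelike (v : V) : Prop := 0 < dot M v v.

Definition unit_spacelike (v : V) : Prop := dot M v v = 1.

Definition future_pointing (v : V) : Prop :=
  [/\ v != 0, dot M v v <= 0 & vclosure (Future M) v].

(* n = (s^-, s^+) *)
Definition null_frame (s : V) (n : V * V) : Prop :=
  [/\ null n.1 /\ future_pointing n.1,
      null n.2 /\ future_pointing n.2,
      dot M n.1 s = 0 /\ dot M n.2 s = 0,
      dot M n.1 n.2 = -1 &
      positive_basis [tuple s; n.1; n.2]].

(* For unit-spacelike s a null frame exists and is unique up to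
   (s^-, s^+) |-> (l s^-, l^-1 s^+) with l > 0; we fix one by choice. *)
Definition nullvec (s : V) : V * V := xget (0, 0) (null_frame s).

Definition nullminus (s : V) : V := (nullvec s).1.
Definition nullplus (s : V) : V := (nullvec s).2.

(** ** The hyperbolic plane *)

Definition H2 : set V := Future M `&` [set v | dot M v v = -1].

Definition halfplane (s : V) : set V := H2 `&` [set v | 0 <= dot M v s].

Definition is_halfplane (h : set V) : Prop :=
  exists2 s, spacelike s & h = halfplane s.

(* the closure, relative to H2, of H2 minus h *)
Definition compl_halfplane (h : set V) : set V :=
  H2 `&` vclosure (H2 `\` h).

End Vectors.

(** ** Affine space and crooked halfspaces *)

(* [vsub q p] is q - p. The origin only witnesses that the space is nonempty. *)
Record affineSpace (V : zmodType) := AffineSpace {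
  pt :> choiceType;
  origin : pt;
  vsub : pt -> pt -> V;
  vsub_chasles : forall p q r, vsub r q + vsub q p = vsub r p;
  vsub_bij : forall p, bijective (vsub ^~ p)
}.

Section Crooked.
Context (R : realType) (V : vectType R) (M : minkowski_structure V).
Context (E : affineSpace V).

(* The topology of V transported by q |-> q - origin; it does not depend on
   the origin. *)
Definition etop : topologicalType :=
  initial_topology (fun q : E => vsub q (origin E) : vtop V).

Definition eclosure (A : set E) : set E := closure (A : set etop).

Definition crooked_halfspace (p : E) (s : V) : set E :=
  [set q | dot M (vsub q p) (nullplus M s) < 0 /\ 0 < dot M (vsub q p) s]
  `|` [set q | [/\ dot M (vsub q p) (nullplus M s) < 0,
                   0 < dot M (vsub q p) (nullminus M s) &
                   dot M (vsub q p) s = 0]]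
  `|` [set q | 0 < dot M (vsub q p) (nullminus M s) /\ dot M (vsub q p) s < 0].

Definition is_director (A : set E) (s : V) : Prop :=
  unit_spacelike M s /\ exists p, A = crooked_halfspace p s.

Definition is_crooked_halfspace (A : set E) : Prop :=
  exists s, is_director A s.

Definition director (A : set E) : V := xget 0 (is_director A).

Definition linearization (A : set E) : set V := halfplane M (director A).

End Crooked.

(* Main.v *)
Require Import Defs.
From mathcomp Require Import all_boot all_order all_algebra.
From mathcomp Require Import all_classical all_reals all_analysis.
From mathcomp Require Import ring lra.

Set Implicit Arguments.
Unset Strict Implicit.
Unset Printing Implicit Defensive.

Import Order.TTheory GRing.Theory Num.Theory.
Import numFieldNormedType.Exports.

Local Open Scope classical_set_scope.
Local Open Scope ring_scope.

(* In a positively oriented orthonormal basis with future-pointing last vector,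
   the null frame of s is explicit up to positive factors, and its two lines are
   exchanged when s is replaced by -s.

   For (i), let H(p,s) be contained in H(p',s') and let v be in Future with
   v . s > 0. Since v is negative on future null vectors, the ray p + tv, t > 0,
   lies in H(p,s), hence in H(p',s'); if v . s' < 0 held, far along the ray the
   products with both s' and s'^- would be negative, which no point of H(p',s')
   allows. So v . s' >= 0, and the boundary case v . s = 0 follows by closure.
   Applied to two descriptions of the same halfspace, this also shows that the
   linearization does not depend on the chosen director.

   For (ii), the closure of H(p,s) is given by the weak inequalities, so its
   complement is H(p,-s). *)

(** * Linear forms, curves and closures in the topology of V *)

Section Topology.
Context (R : realType) (V : vectType R).

(** A linear form is a finite combination of the chart coordinates, which are continuous for the
    initial topology. *)
Lemma linear_vtop_continuous (g : {scalar V}) : continuous (g : vtop V -> R).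
Proof.
have -> : (g : V -> R) =
    (fun v => \sum_i chart v 0 i * g (vbasis {:V})`_i) :> (V -> R).
  apply/funext => v; rewrite {1}(coord_vbasis (memvf v)) linear_sum.
  by apply: eq_bigr => i _; rewrite linearZ /= mxE.
apply: continuous_big; first exact: add_continuous.
move=> i _ v; apply: cvgMr_tmp.
  exact: (@nbhs_filter (vtop V)).
have H : {for v, continuous
    ((fun r : 'rV[R]_(\dim {:V}) => r 0 i) \o (@chart R V : vtop V -> _))}.
  by apply: continuous_comp; [exact: initial_continuous|exact: coord_continuous].
exact: H.
Qed.

Lemma vtop_curve_continuous (f g : R -> R) (v w : V) :
  continuous f -> continuous g ->
  continuous (fun t => f t *: v + g t *: w : vtop V).
Proof.
move=> cf cg; apply: continuous_comp_initial.
have -> : @chart R V \o (fun t => f t *: v + g t *: w : vtop V) =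
    (fun t => f t *: chart v + g t *: chart w).
  by apply/funext => t; apply/rowP => i; rewrite !mxE linearD !linearZ.
by move=> t; apply: cvgD; apply: cvgZr_tmp; [exact: cf|exact: cg].
Qed.

(** Every neighbourhood of [c 0] contains [c t] for small t > 0. Boundary points are reached below
    along such explicit curves. *)
Lemma closure_curve (T : topologicalType) (A : set T) (c : R -> T) :
  continuous c -> (forall t, 0 < t -> A (c t)) -> closure A (c 0).
Proof.
move=> cc Ac B /cc cB.
have [d /= d0 dB] := (proj1 (@nbhs_ballP R R 0 (c @^-1` B))) cB.
have d2 : 0 < d / 2 by rewrite divr_gt0.
exists (c (d / 2)); split; first exact: Ac.
by apply: dB; rewrite /ball /= sub0r normrN gtr0_norm //; lra.
Qed.

Lemma vclosure_curve (A : set V) (f g : R -> R) (v w : V) :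
  continuous f -> continuous g ->
  (forall t, 0 < t -> A (f t *: v + g t *: w)) ->
  vclosure A (f 0 *: v + g 0 *: w).
Proof.
move=> cf cg; apply: (@closure_curve (vtop V) A (fun t => f t *: v + g t *: w)).
exact: vtop_curve_continuous.
Qed.

Lemma closed_le0 (T : topologicalType) (g : T -> R) :
  continuous g -> closed [set v | g v <= 0].
Proof.
move=> cg; apply: (@preimage_closed _ _ g [set x | x <= 0]); last exact: closed_le.
by move=> ? _; exact: cg.
Qed.

Lemma closure_le0 (T : topologicalType) (A : set T) (g : T -> R) (v : T) :
  continuous g -> (forall w, A w -> g w <= 0) -> closure A v -> g v <= 0.
Proof.
move=> cg Ag Av.
have : closure [set w | g w <= 0] v by apply: closureS Av.
by rewrite -((closure_id _).1 (closed_le0 cg)).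
Qed.

End Topology.

(** * Coordinates in a Lorentz basis, and Future in terms of the inner product *)

Definition o0 : 'I_3 := ord0.
Definition o1 : 'I_3 := lift ord0 ord0.
Definition o2 : 'I_3 := ord_max.

Lemma det_mx33 (R : comPzRingType) (A : 'M[R]_3) :
  \det A = A o0 o0 * (A o1 o1 * A o2 o2 - A o1 o2 * A o2 o1)
         - A o0 o1 * (A o1 o0 * A o2 o2 - A o1 o2 * A o2 o0)
         + A o0 o2 * (A o1 o0 * A o2 o1 - A o1 o1 * A o2 o0).
Proof.
rewrite (expand_det_row _ 0) !big_ord_recl big_ord0 /cofactor.
rewrite !(expand_det_row _ 0) !big_ord_recl !big_ord0 /cofactor !det_mx11 !mxE.
(* The expansion produces different ordinal terms for one index; reading entries through [inord]
   makes them identical for [ring]. *)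
pose F i j := A (inord i) (inord j).
have AF i j : A i j = F i j by rewrite /F !inord_val.
rewrite !AF /= /bump /= !add0n !add1n.
rewrite expr0 expr1 expr2.
ring.
Qed.

Section Coordinates.
Context (R : realType) (V : vectType R).
Implicit Types (f : {symmetric V}) (e : 3.-tuple V) (u v w : V).

Definition lorentz_basis (f : {symmetric V}) e := basis_of {:V} e /\
  forall i j : 'I_3, f (tnth e i) (tnth e j) =
      if i == j then (if i == ord_max then -1 else 1) else 0.

Lemma ord3P (P : 'I_3 -> Prop) : P o0 -> P o1 -> P o2 -> forall i, P i.
Proof.
by move=> P0 P1 P2 [[|[|[|//]]] i]; [move: P0|move: P1|move: P2];
  congr P; exact: val_inj.
Qed.

Lemma sum3 (W : nmodType) (F : 'I_3 -> W) : \sum_i F i = F o0 + F o1 + F o2.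
Proof.
rewrite !big_ord_recr big_ord0 /= add0r.
by congr (F _ + F _ + F _); exact: val_inj.
Qed.

Lemma vec3E e v : basis_of {:V} e ->
  v = coord e o0 v *: tnth e o0 + coord e o1 v *: tnth e o1
    + coord e o2 v *: tnth e o2.
Proof. by move=> be; rewrite {1}(coord_basis be (memvf v)) sum3 !(tnth_nth 0). Qed.

Lemma coord_tnth e i j : basis_of {:V} e -> coord e j (tnth e i) = (i == j)%:R.
Proof. by move=> be; rewrite (tnth_nth 0) coord_free ?(basis_free be). Qed.

Lemma lorentz_dot f e v w : lorentz_basis f e ->
  f v w = coord e o0 v * coord e o0 w + coord e o1 v * coord e o1 w
        - coord e o2 v * coord e o2 w.
Proof.
move=> [be G]; rewrite {1}(vec3E v be) {1}(vec3E w be).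
rewrite !linearDl !linearDr !linearZl_LR !linearZr_LR /=.
rewrite !G /= /GRing.scale /=; ring.
Qed.

Definition triple (a b c : R) e : V :=
  a *: tnth e o0 + b *: tnth e o1 + c *: tnth e o2.

Lemma coord_triple e a b c : basis_of {:V} e ->
  [/\ coord e o0 (triple a b c e) = a, coord e o1 (triple a b c e) = b &
      coord e o2 (triple a b c e) = c].
Proof.
move=> be; rewrite /triple !linearD !linearZ /= !coord_tnth //=.
by split; rewrite !(mulr0, mulr1, addr0, add0r).
Qed.

Lemma dotC f u v : f u v = f v u.
Proof. by rewrite hermC expr0 mul1r. Qed.

Lemma dot_continuous f w : continuous (f^~ w : vtop V -> R).
Proof.
have -> : f^~ w = f w by apply/funext => v; rewrite dotC.
exact: (@linear_vtop_continuous R V (f w)).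
Qed.

(** Lagrange's identity bounds the left side by the product of the spatial square norms, each
    smaller than the square of the last coordinate. *)
Lemma timelike_cauchy (x y z x' y' z' : R) :
  x * x + y * y - z * z < 0 -> x' * x' + y' * y' - z' * z' < 0 ->
  (x * x' + y * y') ^+ 2 < (z * z') ^+ 2.
Proof.
move=> H H'.
have -> : (x * x' + y * y') ^+ 2 =
   (x * x + y * y) * (x' * x' + y' * y') - (x * y' - y * x') ^+ 2 by ring.
have S := sqr_ge0 (x * y' - y * x').
have A1 : 0 <= x * x + y * y by nra.
have A2 : 0 <= x' * x' + y' * y' by nra.
have : (x * x + y * y) * (x' * x' + y' * y') < (z * z) * (z' * z').
  by apply: ltr_pM => //; lra.
by rewrite exprMn !expr2 in S *; lra.
Qed.

(** The spatial part is strictly smaller in absolute value than the product of the last coordinates,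
    which therefore decides the sign. *)
Lemma lorentz_timelike f e v w : lorentz_basis f e -> f v v < 0 -> f w w < 0 ->
  (f v w < 0) = (0 < coord e o2 v * coord e o2 w) /\ f v w != 0.
Proof.
move=> ef; rewrite !(lorentz_dot _ _ ef) => H H'.
have := timelike_cauchy H H'.
set p := _ + _; set q := _ * _ => K; split; last first.
  by apply/eqP => /eqP; rewrite subr_eq0 => /eqP E; rewrite E ltxx in K.
rewrite !expr2 in K.
by apply/idP/idP => L; nra.
Qed.

(* The function v |-> v . v0 does not vanish on timelike vectors, so it keeps its
   sign on a component; conversely the timelike v with v . v0 < 0 are joined to
   v0 by a segment of timelike vectors. *)
Lemma Future_dot (M : minkowski_structure V) : exists2 v0,
  dot M v0 v0 < 0 & Future M = [set v | dot M v v < 0 /\ dot M v v0 < 0].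
Proof.
have [e be G] := dot_signature M.
have ef : lorentz_basis (dot M) e by [].
have [v0 v0t ->] := Future_component M; exists v0 => //.
apply/seteqP; split => [v /= [C [Cv0 CT Cc] Cv]|v /= [vt vv0]].
  split; first exact: CT.
  pose g w := dot M w v0.
  have cg : continuous (g : vtop V -> R) by exact: dot_continuous.
  have : connected (g @` (C : set (vtop V))).
    apply: connected_continuous_connected => //.
    exact: continuous_subspaceT.
  move/connected_intervalP => gi.
  rewrite ltNge; apply/negP => gv.
  have [w Cw gw] : (g @` C) 0.
    apply: (gi (g v0) (g v)); [by exists v0|by exists v|].
    by rewrite gv andbT ltW.
  have [_] := lorentz_timelike ef (CT _ Cw) v0t.
  by rewrite -/(g w) gw eqxx.
exists [set (1 - t) *: v0 + t *: v | t in (`[0, 1]%classic : set R)]; last first.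
  by exists 1; rewrite ?subrr ?scale0r ?add0r ?scale1r //= in_itv /= ler01 lexx.
split.
- by exists 0; rewrite ?subr0 ?scale0r ?addr0 ?scale1r //= in_itv /= ler01 lexx.
- move=> w [t /=]; rewrite in_itv /= => /andP[t0 t1] <-; rewrite /timelike_set /=.
  rewrite !linearDl !linearDr !linearZl_LR !linearZr_LR /=.
  rewrite (dotC _ v0 v) /GRing.scale /=.
  have : dot M v0 v0 < 0 by [].
  move: (dot M v v0) (dot M v0 v0) (dot M v v) vt vv0 => a b c vt vv0 b0.
  (* The square at t is (1 - t)^2 b + 2 t (1 - t) a + t^2 c, with no positive term. For t > 0 the
     last term is strictly negative, for t = 0 the first one is. *)
  have [-> |tn0] := eqVneq t 0; first by lra.
  have {}t0 : 0 < t by rewrite lt_neqAle eq_sym tn0.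
  have h1 : t * t * c < 0 by rewrite pmulr_rlt0 // mulr_gt0.
  have h2 : (1 - t) * (1 - t) * b <= 0.
    by rewrite mulr_ge0_le0 ?mulr_ge0 ?subr_ge0 // ltW.
  have h3 : t * (1 - t) * a <= 0.
    by rewrite mulr_ge0_le0 ?mulr_ge0 ?subr_ge0 // ltW.
  by lra.
- apply: connected_continuous_connected.
    by apply/connected_intervalP; exact: interval_is_interval.
  apply: continuous_subspaceT; apply: vtop_curve_continuous => t.
    by apply: cvgB; [exact: cvg_cst|exact: cvg_id].
  exact: cvg_id.
Qed.

End Coordinates.

(** * Orthonormal bases adapted to the orientation and the time-orientation *)

Section AdaptedBasis.
Context (R : realType) (V : vectType R) (M : minkowski_structure V).
Implicit Types (e : 3.-tuple V) (u v w : V).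

(** Turns the connected component and the reference basis stored in [M] into sign conditions on
    coordinates. *)
Record adapted e : Prop := Adapted {
  adapted_lorentz : lorentz_basis (dot M) e;
  adapted_Future : forall v,
    Future M v <-> dot M v v < 0 /\ 0 < coord e o2 v;
  adapted_positive : forall t : 3.-tuple V, positive_basis M t <->
    0 < \det (\matrix_(i < 3, j < 3) coord e j (tnth t i))
}.

(** Used with signs: [b] adjusts the time-orientation, then [a] the orientation. *)
Definition flip (a b : R) e : 3.-tuple V :=
  [tuple a *: tnth e o0; tnth e o1; b *: tnth e o2].

(** Pairing a vanishing combination with each vector isolates one coefficient up to sign, so the
    triple is free, hence a basis in dimension 3. *)
Lemma lorentz_of_dim (f : {symmetric V}) e : \dim {:V} = 3%N ->
  (forall i j : 'I_3, f (tnth e i) (tnth e j) =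
      if i == j then (if i == ord_max then -1 else 1) else 0) ->
  lorentz_basis f e.
Proof.
move=> d3 G; split; last exact: G.
rewrite basisEfree subvf size_tuple d3 leqnn !andbT.
apply/freeP => k; rewrite sum3 -!tnth_nth => k0.
have H i : f (k o0 *: tnth e o0 + k o1 *: tnth e o1 + k o2 *: tnth e o2)
    (tnth e i) = 0 by rewrite k0 linear0l.
apply: ord3P.
- by move: (H o0); rewrite !linearDl !linearZl_LR /= !G /GRing.scale /= => ?; lra.
- by move: (H o1); rewrite !linearDl !linearZl_LR /= !G /GRing.scale /= => ?; lra.
- by move: (H o2); rewrite !linearDl !linearZl_LR /= !G /GRing.scale /= => ?; lra.
Qed.

Lemma lorentz_flip (f : {symmetric V}) e a b : a * a = 1 -> b * b = 1 ->
  lorentz_basis f e -> lorentz_basis f (flip a b e).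
Proof.
move=> aa bb [be G]; apply: lorentz_of_dim.
  by rewrite (size_basis be).
by do 2!apply: ord3P;
  rewrite /flip ?(linearZl_LR, linearZr_LR) /= !G /GRing.scale /=;
  rewrite ?mulr0 ?mulr1 // ?mulrN ?mulr1 ?mulrA ?aa ?bb.
Qed.

Lemma det_coord (e1 e2 t : 3.-tuple V) : basis_of {:V} e2 ->
  \det (\matrix_(i < 3, j < 3) coord e1 j (tnth t i)) =
  \det (\matrix_(i < 3, j < 3) coord e2 j (tnth t i)) *
  \det (\matrix_(i < 3, j < 3) coord e1 j (tnth e2 i)).
Proof.
move=> b2; rewrite -det_mulmx; congr (\det _); apply/matrixP => i j.
rewrite !mxE {1}(coord_basis b2 (memvf (tnth t i))) linear_sum.
by apply: eq_bigr => k _; rewrite !mxE linearZ [tnth e2 k](tnth_nth 0).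
Qed.

(** The determinants of the passages from one basis to the other and back multiply to 1. *)
Lemma det_coord_neq0 (e1 e2 : 3.-tuple V) :
  basis_of {:V} e1 -> basis_of {:V} e2 ->
  \det (\matrix_(i < 3, j < 3) coord e1 j (tnth e2 i)) != 0.
Proof.
move=> b1 b2; have := det_coord e1 e1 b2.
have -> : (\matrix_(i < 3, j < 3) coord e1 j (tnth e1 i)) = 1%:M.
  by apply/matrixP => i j; rewrite !mxE coord_tnth.
by rewrite det1 => H; apply/eqP => Z; move/eqP: H; rewrite Z mulr0 oner_eq0.
Qed.

Lemma adapted_exists : exists e, adapted e.
Proof.
have [e be G] := dot_signature M.
have ef : lorentz_basis (dot M) e by [].
have [v0 v0t FE] := Future_dot M.
pose d (t : 3.-tuple V) :=
  \det (\matrix_(i < 3, j < 3) coord (oriented_basis M) j (tnth t i)).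
(* [b] makes the last coordinate of [v0], which lies in Future, positive. The factor [b] in [a]
   makes a b, the determinant of the flip, equal to the sign of [d e]. *)
pose b := Num.sg (coord e o2 v0).
pose a := Num.sg (d e) * b.
have d0 : d e != 0 := det_coord_neq0 (oriented_basisP M) be.
have z0 : coord e o2 v0 != 0.
  apply/eqP => Z; move: v0t; rewrite (lorentz_dot _ _ ef) Z.
  by have := sqr_ge0 (coord e o0 v0); have := sqr_ge0 (coord e o1 v0);
     rewrite !expr2; lra.
have bb : b * b = 1 by rewrite /b -expr2 sqr_sg z0.
have aa : a * a = 1.
  by rewrite /a mulrACA bb mulr1 -expr2 sqr_sg d0.
have eF := lorentz_flip aa bb ef.
exists (flip a b e); split => //.
- move=> v; rewrite FE /=.
  have H : dot M v v < 0 ->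
      (dot M v v0 < 0) = (0 < coord (flip a b e) o2 v).
    move=> vt; rewrite (lorentz_timelike ef vt v0t).1.
    have -> : coord e o2 v = b * coord (flip a b e) o2 v.
      have f0 : tnth (flip a b e) o0 = a *: tnth e o0 by [].
      have f1 : tnth (flip a b e) o1 = tnth e o1 by [].
      have f2 : tnth (flip a b e) o2 = b *: tnth e o2 by [].
      rewrite {1}(vec3E v eF.1) f0 f1 f2 !linearD !linearZ /=.
      by rewrite !coord_tnth //= !(mulr0, mulr1, addr0, add0r) mulrC.
    by rewrite mulrAC /b -normrEsg pmulr_rgt0 // normr_gt0.
  by split => -[vt]; [rewrite H|rewrite -H].
- move=> t; rewrite /positive_basis /same_orientation (det_coord _ _ eF.1).
  rewrite pmulr_lgt0 //.
  rewrite (det_coord _ _ be) -/(d e).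
  have -> : \det (\matrix_(i < 3, j < 3) coord e j (tnth (flip a b e) i)) = a * b.
    have f0 : tnth (flip a b e) o0 = a *: tnth e o0 by [].
    have f1 : tnth (flip a b e) o1 = tnth e o1 by [].
    have f2 : tnth (flip a b e) o2 = b *: tnth e o2 by [].
    rewrite det_mx33 !mxE f0 f1 f2 ![coord _ _ (_ *: _)]linearZ /=.
    by rewrite !coord_tnth //= !(mulr0, mul0r, mulr1, mul1r, subr0, addr0).
  by rewrite /a -mulrA bb mulr1 -normrEsg normr_gt0.
Qed.

End AdaptedBasis.

(** * Null directions orthogonal to a unit-spacelike vector *)

Section NullFrames.
Context (R : realType) (V : vectType R) (M : minkowski_structure V).
Context (e : 3.-tuple V) (eM : adapted M e).
Implicit Types (u v w s n : V).

Let be : basis_of {:V} e := (adapted_lorentz eM).1.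
Let dotE v w := lorentz_dot v w (adapted_lorentz eM).

(* The future null direction of s^perp carrying s^-; the one carrying s^+ is
   edge (- s). Dropping the normalization s^- . s^+ = -1 makes the coordinates
   polynomial in those of s. *)
Definition edge s : V :=
  let a := coord e o0 s in let b := coord e o1 s in let c := coord e o2 s in
  triple (c * a - b) (c * b + a) (a * a + b * b) e.

Lemma coord_edge s :
  let a := coord e o0 s in let b := coord e o1 s in let c := coord e o2 s in
  [/\ coord e o0 (edge s) = c * a - b, coord e o1 (edge s) = c * b + a &
      coord e o2 (edge s) = a * a + b * b].
Proof. exact: coord_triple. Qed.

Lemma vec_eq v w : coord e o0 v = coord e o0 w -> coord e o1 v = coord e o1 w ->
  coord e o2 v = coord e o2 w -> v = w.
Proof. by move=> h0 h1 h2; rewrite (vec3E v be) (vec3E w be) h0 h1 h2. Qed.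

Lemma FutureE v : Future M v <->
  coord e o0 v * coord e o0 v + coord e o1 v * coord e o1 v
    < coord e o2 v * coord e o2 v /\ 0 < coord e o2 v.
Proof. by rewrite (adapted_Future eM) dotE subr_lt0. Qed.

Lemma unit_spacelikeE s : unit_spacelike M s ->
  coord e o0 s * coord e o0 s + coord e o1 s * coord e o1 s
    = 1 + coord e o2 s * coord e o2 s.
Proof. by rewrite /unit_spacelike dotE => <-; rewrite subrK. Qed.

Lemma unit_spacelikeN s : unit_spacelike M s -> unit_spacelike M (- s).
Proof. by rewrite /unit_spacelike linearNl linearNr opprK. Qed.

Lemma dot_edge s : dot M (edge s) s = 0.
Proof. by rewrite dotE; have [-> -> ->] := coord_edge s; ring. Qed.

Lemma dot_edgeN s : unit_spacelike M s ->
  dot M (edge s) (edge (- s)) = - (2 + 2 * coord e o2 s ^+ 2).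
Proof.
move=> /unit_spacelikeE/(canRL (addrK _)) us; rewrite dotE.
have [-> -> ->] := coord_edge s; have [-> -> ->] := coord_edge (- s).
rewrite !linearN /=; ring: us.
Qed.

Lemma dot_edge_edge s : unit_spacelike M s -> dot M (edge s) (edge s) = 0.
Proof.
move=> /unit_spacelikeE/(canRL (addrK _)) us; rewrite dotE.
have [-> -> ->] := coord_edge s; ring: us.
Qed.

(** The last coordinate is nonnegative on the closure of Future, and a null vector where it vanishes
    is zero. Conversely, adding a positive multiple of the last basis vector pushes n into
    Future. *)
Lemma null_future_pointingP n :
  null M n /\ future_pointing M n <-> dot M n n = 0 /\ 0 < coord e o2 n.
Proof.
split=> [[[n0 nn] [_ _ cn]]|[nn z0]].
  split=> //; rewrite lt_neqAle; apply/andP; split.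
    apply: contraNneq n0 => z0; apply/eqP; move: nn; rewrite dotE -z0 => nn.
    have Y := sqr_ge0 (coord e o1 n); have X := sqr_ge0 (coord e o0 n).
    rewrite !expr2 in X Y.
    apply: vec_eq; rewrite ?linear0 //=.
      by apply/eqP; rewrite -sqrf_eq0 expr2; apply/eqP; lra.
    by apply/eqP; rewrite -sqrf_eq0 expr2; apply/eqP; lra.
  rewrite -oppr_le0 -linearN /=.
  have := @closure_le0 R (vtop V) (Future M) (fun v => coord e o2 (- v)) n.
  apply=> //.
    have -> : (fun v => coord e o2 (- v)) = (fun v => -1 * coord e o2 v).
      by apply/funext => v; rewrite linearN mulN1r.
    move=> v; apply: cvgMl_tmp; first exact: (@nbhs_filter (vtop V)).
    exact: linear_vtop_continuous.
  by move=> w /FutureE [_ w0]; rewrite linearN oppr_le0 ltW.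
have n0 : n != 0 by apply: contraTneq z0 => ->; rewrite linear0 ltxx.
split; split=> //; first by rewrite nn.
have := @vclosure_curve R V (Future M) (fun=> 1) id n (tnth e o2).
rewrite scale0r addr0 scale1r; apply.
- exact: cst_continuous.
- by move=> t; exact: cvg_id.
move=> t t0; apply/FutureE.
rewrite !linearD /= ![coord _ _ (_ *: _)]linearZ /= !coord_tnth //=.
move: nn; rewrite dotE !mulr0 !addr0 mulr1 => nn; split; nra.
Qed.

(** The form has signature (1,1) on the plane orthogonal to s, so its null vectors form two lines,
    each with one future ray. *)
Lemma null_future_perp s n : unit_spacelike M s ->
  dot M n s = 0 -> dot M n n = 0 -> 0 < coord e o2 n ->
  (exists2 l, 0 < l & n = l *: edge s) \/ (exists2 l, 0 < l & n = l *: edge (- s)).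
Proof.
move=> /unit_spacelikeE; rewrite !dotE.
set a := coord e o0 s; set b := coord e o1 s; set c := coord e o2 s.
set x := coord e o0 n; set y := coord e o1 n; set z := coord e o2 n.
move=> us ns nn z0.
(* The cross term of Lagrange's identity for (a, b) and (x, y); the three hypotheses force k^2 =
   z^2, one sign for each ray. *)
pose k := b * x - a * y.
have nsz : x * a + y * b = z * c by lra.
have r0 : 0 < a * a + b * b by rewrite us; have := sqr_ge0 c; rewrite expr2; lra.
have rn : a * a + b * b != 0 by rewrite gt_eqF.
have kz : (k - z) * (k + z) = 0.
  have -> : (k - z) * (k + z) = (a * a + b * b) * (x * x + y * y)
    - (x * a + y * b) ^+ 2 - z * z by rewrite /k; ring.
  rewrite nsz.
  have -> : x * x + y * y = z * z by lra.
  by rewrite us; ring.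
have l0 : 0 < z / (a * a + b * b) by rewrite divr_gt0.
(* Recovers (x, y) from its products z c and k with the orthogonal vectors (a, b) and (b, -a). *)
have X : (a * a + b * b) * x = c * a * z + b * k.
  have -> : c * a * z = a * (z * c) by ring.
  by rewrite -nsz /k; ring.
have Y : (a * a + b * b) * y = c * b * z - a * k.
  have -> : c * b * z = b * (z * c) by ring.
  by rewrite -nsz /k; ring.
move/eqP: kz; rewrite mulf_eq0 => /orP[]/eqP kz; [right|left];
  exists (z / (a * a + b * b)) => //.
- have {}kz : k = z by lra.
  have [E0 E1 E2] := coord_edge (- s).
  apply: vec_eq; rewrite linearZ /= ?E0 ?E1 ?E2 !linearN /= -/a -/b -/c;
    apply: (mulfI rn); rewrite ?X ?Y ?kz; field => //.
- have {}kz : k = - z by lra.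
  have [E0 E1 E2] := coord_edge s.
  apply: vec_eq; rewrite linearZ /= ?E0 ?E1 ?E2 /= -/a -/b -/c;
    apply: (mulfI rn); rewrite ?X ?Y ?kz; field => //.
Qed.

Lemma positive_basisE s u v : positive_basis M [tuple s; u; v] <->
  0 < coord e o0 s * (coord e o1 u * coord e o2 v - coord e o2 u * coord e o1 v)
    - coord e o1 s * (coord e o0 u * coord e o2 v - coord e o2 u * coord e o0 v)
    + coord e o2 s * (coord e o0 u * coord e o1 v - coord e o1 u * coord e o0 v).
Proof. by rewrite (adapted_positive eM) det_mx33 !mxE. Qed.

(** The determinants are 2 (a^2 + b^2) l l' and its opposite, so the orientation decides which edge
    carries s^-. *)
Lemma positive_edges s l l' : unit_spacelike M s ->
  (positive_basis M [tuple s; l *: edge s; l' *: edge (- s)] <-> 0 < l * l') /\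
  (positive_basis M [tuple s; l *: edge (- s); l' *: edge s] <-> l * l' < 0).
Proof.
move=> /unit_spacelikeE us; rewrite !positive_basisE ![coord _ _ (_ *: _)]linearZ /=.
have [-> -> ->] := coord_edge s; have [-> -> ->] := coord_edge (- s).
rewrite !linearN /=; move: us.
set a := coord e o0 s; set b := coord e o1 s; set c := coord e o2 s => us.
have r0 : 0 < 2 * (a * a + b * b).
  by rewrite us; have := sqr_ge0 c; rewrite expr2; lra.
have us' := canRL (addrK _) us.
rewrite -(pmulr_rgt0 (l * l') r0) -(pmulr_rlt0 (l * l') r0) -oppr_gt0.
split; (match goal with |- is_true (_ < ?x) <-> is_true (_ < ?y) =>
  have -> : x = y by ring: us' end); by [].
Qed.

(** Two vectors on one null ray would have product 0 instead of -1, and the exchanged order of the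
    rays is negatively oriented. *)
Lemma null_frame_edges s (n : V * V) : unit_spacelike M s -> null_frame M s n ->
  exists l l', [/\ 0 < l, 0 < l', n.1 = l *: edge s & n.2 = l' *: edge (- s)].
Proof.
move=> us [/null_future_pointingP[n11 z1] /null_future_pointingP[n22 z2]
  [n1s n2s] n12 pos].
have N0 : (0 : R) <> -1 by move=> ?; lra.
have [[l l0 E1]|[l l0 E1]] := null_future_perp us n1s n11 z1;
have [[l' l0' E2]|[l' l0' E2]] := null_future_perp us n2s n22 z2.
- move: n12; rewrite E1 E2 linearZl_LR linearZr_LR /= dot_edge_edge //.
  by rewrite /GRing.scale /= !mulr0.
- by exists l, l'.
- move: pos; rewrite E1 E2 => /(positive_edges l l' us).2.
  by move=> L; have := mulr_gt0 l0 l0'; lra.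
- move: n12; rewrite E1 E2 linearZl_LR linearZr_LR /= dot_edge_edge.
    by rewrite /GRing.scale /= !mulr0.
  exact: unit_spacelikeN.
Qed.

Lemma null_frame_exists s : unit_spacelike M s -> exists n : V * V, null_frame M s n.
Proof.
(* [r] is minus the product of the two edges; dividing one edge by it gives the normalization -1. *)
move=> us; pose r := 2 + 2 * coord e o2 s ^+ 2.
have r0 : 0 < r by have := sqr_ge0 (coord e o2 s); rewrite /r; lra.
have zE v : unit_spacelike M v -> 0 < coord e o2 (edge v).
  move=> /unit_spacelikeE uv; have [_ _ ->] := coord_edge v.
  by rewrite uv; have := sqr_ge0 (coord e o2 v); rewrite expr2; lra.
have usN := unit_spacelikeN us.
have ri : 0 < r^-1 by rewrite invr_gt0.
have ps : dot M (edge (- s)) s = 0.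
  by have /eqP := dot_edge (- s); rewrite linearNr oppr_eq0 => /eqP.
exists (1 *: edge s, r^-1 *: edge (- s)); split => /=.
- by apply/null_future_pointingP; rewrite scale1r dot_edge_edge //; split=> //; exact: zE.
- apply/null_future_pointingP; rewrite linearZl_LR linearZr_LR /= dot_edge_edge //.
  rewrite /GRing.scale /= !mulr0; split=> //.
  by rewrite linearZ /= mulr_gt0 ?zE.
- by rewrite scale1r linearZl_LR /= ps dot_edge mulr0.
- rewrite scale1r linearZr_LR /= dot_edgeN // -/r /GRing.scale /=.
  by rewrite mulrN mulVf ?gt_eqF.
- by apply/(positive_edges _ _ us).1; rewrite mul1r.
Qed.

(** Since a null frame exists, the default (0, 0) is never chosen. The positive factors do not
    affect the signs that define crooked halfspaces. *)
Lemma nullvec_edges s : unit_spacelike M s ->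
  exists l l', [/\ 0 < l, 0 < l', nullminus M s = l *: edge s &
    nullplus M s = l' *: edge (- s)].
Proof.
move=> us; apply: null_frame_edges => //; have [n ns] := null_frame_exists us.
by apply: (@xgetI _ (0, 0) (null_frame M s) n).
Qed.

End NullFrames.

(** * Halfplanes of the hyperbolic plane, their complements and inclusions *)

Section Halfplanes.
Context (R : realType) (V : vectType R) (M : minkowski_structure V).
Context (e : 3.-tuple V) (eM : adapted M e).
Implicit Types (u v w s n : V).

(** Cauchy-Schwarz on the spatial parts, strict because v is timelike while the edge is null with
    positive last coordinate. *)
Lemma Future_edge v s : unit_spacelike M s -> Future M v ->
  dot M v (edge e s) < 0.
Proof.
move=> us /(FutureE eM)[vt v0]; have := dot_edge_edge eM us.
have : 0 < coord e o2 (edge e s).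
  have [_ _ ->] := coord_edge eM s; rewrite (unit_spacelikeE eM us).
  by have := sqr_ge0 (coord e o2 s); rewrite expr2; lra.
rewrite !(lorentz_dot _ _ (adapted_lorentz eM)) => z0.
move: (coord e o0 (edge e s)) (coord e o1 (edge e s)) z0.
move: (coord e o2 (edge e s)) (coord e o0 v) (coord e o1 v) vt v0.
move: (coord e o2 v) => z c x y vt v0 a b c0 n0.
have E : (x * a + y * b) ^+ 2 + (x * b - y * a) ^+ 2 =
    (x * x + y * y) * (a * a + b * b) by ring.
have S := sqr_ge0 (x * b - y * a).
have n1 : a * a + b * b = c * c by lra.
have L : (x * x + y * y) * (c * c) < (z * z) * (c * c).
  by rewrite ltr_pM2r // mulr_gt0.
have zc : 0 < z * c by rewrite mulr_gt0.
rewrite n1 in E; rewrite subr_lt0 ltNge; apply/negP => K.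
have : (z * c) ^+ 2 <= (x * a + y * b) ^+ 2 by rewrite lerXn2r ?nnegrE //; lra.
by rewrite exprMn !expr2 in E S *; lra.
Qed.

Lemma Future_same_cone v w : Future M v -> dot M w w < 0 -> dot M w v < 0 ->
  Future M w.
Proof.
move=> Fv wt; have [vt v0] := (adapted_Future eM v).1 Fv.
rewrite (lorentz_timelike (adapted_lorentz eM) wt vt).1 pmulr_lgt0 // => w0.
exact/(adapted_Future eM).
Qed.

(** The weak inequality passes to the closure. Conversely, points with v . s < 0 lie outside the
    halfplane already, and only those of the bounding geodesic have to be approximated. *)
Lemma compl_halfplaneE s : unit_spacelike M s ->
  compl_halfplane M (halfplane M s) = halfplane M (- s).
Proof.
move=> us; apply/seteqP; split => v; rewrite /compl_halfplane /halfplane /=.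
  move=> [Hv cv]; split => //; rewrite linearNr oppr_ge0.
  apply: (@closure_le0 R (vtop V) _ ((dot M)^~ s) v _ _ cv).
    exact: dot_continuous.
  by move=> w [Hw Nw]; rewrite leNgt; apply/negP => L; apply: Nw; split=> //; rewrite /= ltW.
move=> [[Fv vv]]; rewrite linearNr oppr_ge0 le_eqVlt => vs; split=> //.
have /orP[/eqP {}vs|{}vs] := vs; last first.
  apply: subset_closure; split=> //.
  by move=> [_ /=]; rewrite leNgt vs.
(* sqrt (1 + t^2) v - t s runs along the geodesic of H2 through v in direction - s *)
have := @vclosure_curve R V (H2 M `\` halfplane M s)
   (fun t => Num.sqrt (1 + t ^+ 2)) (fun t => t) v (- s).
rewrite scale0r addr0 expr0n addr0 sqrtr1 scale1r; apply.
- move=> t; apply: (@continuous_comp _ _ _ (fun t : R => 1 + t ^+ 2)).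
    by apply: cvgD; [exact: cvg_cst|exact: exprn_continuous].
  exact: sqrt_continuous.
- by move=> t; exact: cvg_id.
move=> t t0.
have r0 : 0 <= 1 + t ^+ 2 by have := sqr_ge0 t; lra.
have c0 : 0 < Num.sqrt (1 + t ^+ 2).
  by rewrite sqrtr_gt0; have := sqr_ge0 t; lra.
have cc := sqr_sqrtr r0.
move: (Num.sqrt _) c0 cc => c c0 cc.
have dotw u : dot M (c *: v + t *: - s) u = c * dot M v u - t * dot M s u.
  by rewrite linearDl !linearZl_LR linearNl /GRing.scale /= mulrN.
have ww : dot M (c *: v + t *: - s) (c *: v + t *: - s) = -1.
  rewrite dotw !linearDr !linearZr_LR !linearNr /GRing.scale /=.
  have ss : dot M s s = 1 by exact: us.
  rewrite (dotC _ s v) vs vv ss; ring: cc.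
split; last by move=> [_ /=]; rewrite dotw vs (us : dot M s s = 1) leNgt mulr0 mulr1 sub0r oppr_lt0 t0.
split=> //; apply: (Future_same_cone Fv); first by rewrite ww; lra.
by rewrite dotw (dotC _ s v) vs vv; lra.
Qed.

Lemma halfplane_le s s' : unit_spacelike M s ->
  (forall v, Future M v -> 0 < dot M v s -> 0 <= dot M v s') ->
  halfplane M s `<=` halfplane M s'.
Proof.
(* Seen as the complement of the halfplane of -s, the halfplane of s is the closure of its points
   with w . s > 0. *)
move=> us ss' v; rewrite -{1}(opprK s) -compl_halfplaneE; last exact: unit_spacelikeN.
move=> [Hv cv]; split => //=; rewrite -oppr_le0 -linearNr.
apply: (@closure_le0 R (vtop V) _ ((dot M)^~ (- s')) v _ _ cv).
  exact: dot_continuous.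
move=> w [[Fw ww] Nw]; rewrite linearNr oppr_le0; apply: ss' => //.
rewrite ltNge; apply/negP => ws; apply: Nw; split=> //=.
by rewrite linearNr oppr_ge0.
Qed.

End Halfplanes.

(** * Crooked halfspaces: inclusion, closure and complement *)

Section Crooked.
Context (R : realType) (V : vectType R) (M : minkowski_structure V).
Context (e : 3.-tuple V) (eM : adapted M e) (E : affineSpace V).
Implicit Types (p q : E) (u v w s : V).

(** The crooked halfspace at vertex 0, with the chosen null frame replaced by the edges, polynomial
    in the coordinates of s. *)
Definition in_crooked s v :=
  [\/ dot M v (edge e (- s)) < 0 /\ 0 < dot M v s,
      [/\ dot M v (edge e (- s)) < 0, 0 < dot M v (edge e s) & dot M v s = 0] |
      0 < dot M v (edge e s) /\ dot M v s < 0].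

(** On the plane v . s = 0 either weak inequality suffices, whereas the open halfspace requires both
    strict ones. *)
Definition in_crooked_closed s v :=
  0 <= dot M v s /\ dot M v (edge e (- s)) <= 0 \/
  dot M v s <= 0 /\ 0 <= dot M v (edge e s).

Lemma crooked_halfspaceE p s q : unit_spacelike M s ->
  crooked_halfspace M p s q <-> in_crooked s (vsub q p).
Proof.
move=> us; have [l [l' [l0 l0' mE pE]]] := nullvec_edges eM us.
rewrite /crooked_halfspace /in_crooked /= mE pE !linearZr_LR /=.
rewrite pmulr_rlt0 // pmulr_rgt0 //.
by split => [[[]|]|[]]; [constructor 1|constructor 2|constructor 3|left; left|left; right|right].
Qed.

(** Passing from s to -s exchanges the two edges; the rest is a case distinction on the sign of v .
    s. *)
Lemma in_crookedN s v : in_crooked (- s) v <-> ~ in_crooked_closed s v.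
Proof.
rewrite /in_crooked /in_crooked_closed opprK linearNr /=.
move: (dot M v s) (dot M v (edge e s)) (dot M v (edge e (- s))) => a m p.
split=> [[[? ?]|[? ? ?]|[? ?]] [[? ?]|[? ?]]|N]; try lra.
have [a0|a0|a0] := ltgtP a 0.
- constructor 1; split; last lra.
  by rewrite ltNge; apply/negP => ?; apply: N; right; lra.
- constructor 3; split; last lra.
  by rewrite ltNge; apply/negP => ?; apply: N; left; lra.
- constructor 2; split; last lra.
    by rewrite ltNge; apply/negP => ?; apply: N; right; lra.
  by rewrite ltNge; apply/negP => ?; apply: N; left; lra.
Qed.

Lemma vsub_surj p v : exists q, vsub q p = v.
Proof. by have [g _ gK] := vsub_bij p; exists (g v); rewrite gK. Qed.

Lemma crooked_subset_dot p p' s s' : unit_spacelike M s -> unit_spacelike M s' ->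
  crooked_halfspace M p s `<=` crooked_halfspace M p' s' ->
  forall v, Future M v -> 0 < dot M v s -> 0 <= dot M v s'.
Proof.
move=> us us' sub v Fv vs; rewrite leNgt; apply/negP => vs'.
have vm := Future_edge eM us' Fv.
have vp := Future_edge eM (unit_spacelikeN us) Fv.
pose w := vsub p p'.
have H t : 0 < t -> in_crooked s' (w + t *: v).
  move=> t0; have [q qE] := vsub_surj p (t *: v).
  have : crooked_halfspace M p s q.
    apply/crooked_halfspaceE => //; rewrite qE; constructor 1.
    by rewrite !linearZl_LR /= pmulr_rlt0 // pmulr_rgt0.
  move/sub/(crooked_halfspaceE _ _ us').
  by rewrite -(vsub_chasles p' p q) qE addrC.
(* For b < 0 the affine function a + t b is negative beyond t = -a / b, hence beyond [k a b]. *)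
pose k (a b : R) := `|a / b|.
have kP (a b t : R) : b < 0 -> k a b < t -> a + t * b < 0.
  move=> b0; rewrite /k ltr_norml => /andP[+ _].
  by rewrite ltr_ndivlMr // => ?; lra.
(* Strictly beyond both thresholds, so that the products with s' and its edge are both negative,
   which every clause of [in_crooked] excludes. *)
pose t := 1 + k (dot M w s') (dot M v s')
            + k (dot M w (edge e s')) (dot M v (edge e s')).
have t0 : 0 < t by rewrite /t /k; do 2 rewrite ltr_wpDr //.
have := H t t0; rewrite /in_crooked !linearDl !linearZl_LR /=.
have k0 a b : 0 <= k a b by exact: normr_ge0.
have L1 : dot M w s' + t * dot M v s' < 0.
  apply: kP => //; rewrite /t; move: (k0 (dot M w (edge e s')) (dot M v (edge e s'))); lra.
have L2 : dot M w (edge e s') + t * dot M v (edge e s') < 0.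
  apply: kP => //; rewrite /t; move: (k0 (dot M w s') (dot M v s')); lra.
by case=> [[_]|[_ ? ?]|[]]; lra.
Qed.

Lemma eclosure_crooked p s : unit_spacelike M s ->
  eclosure (crooked_halfspace M p s) = [set q | in_crooked_closed s (vsub q p)].
Proof.
move=> us.
pose o := origin E.
have vsubE q : vsub q p = vsub q o - vsub p o.
  by rewrite -(vsub_chasles o p q) addrK.
have cd n : continuous (fun q : etop E => dot M (vsub q p) n).
  have -> : (fun q => dot M (vsub q p) n) =
      (fun x => dot M x n - dot M (vsub p o) n) \o (fun q => vsub q o).
    by apply/funext => q; rewrite /= vsubE linearBl.
  move=> q; apply: (@continuous_comp (etop E) (vtop V) R (fun q => vsub q o)
    (fun x => dot M x n - dot M (vsub p o) n)).
    exact: (@initial_continuous E (vtop V) (fun q : E => vsub q o)).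
  apply: cvgB; first exact: (@nbhs_filter (vtop V)).
    exact: (@dot_continuous R V (dot M) n (vsub q o)).
  exact: (@cst_continuous (vtop V)).
apply/seteqP; split => q.
  have cl : closed ([set q | in_crooked_closed s (vsub q p)] : set (etop E)).
    have -> : [set q | in_crooked_closed s (vsub q p)] =
        [set q | dot M (vsub q p) (- s) <= 0] `&`
        [set q | dot M (vsub q p) (edge e (- s)) <= 0] `|`
        [set q | dot M (vsub q p) s <= 0] `&`
        [set q | dot M (vsub q p) (- edge e s) <= 0].
      by apply/seteqP; split=> x; rewrite /in_crooked_closed /= !linearNr !oppr_le0.
    by apply: closedU; apply: closedI; apply: closed_le0; exact: cd.
  move=> cq.
  have : closure ([set q | in_crooked_closed s (vsub q p)] : set (etop E)) q.
    apply: closureS cq => x /(crooked_halfspaceE _ _ us) /=.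
    rewrite /in_crooked /in_crooked_closed.
    by move=> [[? ?]|[? ? ?]|[? ?]]; [left|left|right]; split; lra.
  by rewrite -((closure_id _).1 cl).
have [c cK Kc] := vsub_bij o.
(* The straight line through q with direction [d]; it remains to find a [d] that enters the open
   halfspace at once. *)
pose g d t : etop E := c (vsub q o + t *: d).
have g0 d : g d 0 = q by rewrite /g scale0r addr0 cK.
have gE d t : vsub (g d t) p = vsub q p + t *: d.
  by rewrite vsubE Kc addrAC -vsubE.
have cg d : continuous (g d).
  apply: continuous_comp_initial.
  have -> : (fun q : E => vsub q o : vtop V) \o g d =
      (fun t => 1 *: vsub q o + t *: d : vtop V).
    by apply/funext => t; rewrite /= /g Kc scale1r.
  apply: vtop_curve_continuous; first exact: cst_continuous.
  by move=> t; exact: cvg_id.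
have in_cl d : (forall t, 0 < t -> in_crooked s (vsub q p + t *: d)) ->
    eclosure (crooked_halfspace M p s) q.
  move=> H; rewrite -(g0 d); apply: (closure_curve (cg d)) => t t0.
  by apply/crooked_halfspaceE => //; rewrite gE; exact: H.
have usN := unit_spacelikeN us.
have r0 : dot M (edge e s) (edge e (- s)) < 0.
  by rewrite (dot_edgeN eM us); have := sqr_ge0 (coord e o2 s); lra.
have ps : dot M (edge e (- s)) s = 0.
  by have /eqP := dot_edge eM (- s); rewrite linearNr oppr_eq0 => /eqP.
have ss : dot M s s = 1 by exact: us.
have ms := dot_edge eM s.
have sm : dot M s (edge e s) = 0 by rewrite dotC.
have sp : dot M s (edge e (- s)) = 0 by rewrite dotC.
have dotl v t a b x : dot M (v + t *: (a + b)) x =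
    dot M v x + t * (dot M a x + dot M b x).
  by rewrite !linearDl linearZl_LR linearDl.
have dotN a x : dot M (- a) x = - dot M a x by rewrite linearNl.
case=> [[a0 p0]|[a0 m0]].
(* This direction increases the product with s and, as the two edges have negative product,
   decreases the one with the edge of -s. *)
- apply: (in_cl (s + edge e s)) => t t0; constructor 1.
  rewrite !dotl ms ss sp.
  have : t * dot M (edge e s) (edge e (- s)) < 0 by rewrite pmulr_rlt0.
  by move=> ?; split; lra.
(* Symmetrically, the product with s decreases and the one with its edge increases. *)
- apply: (in_cl (- s + - edge e (- s))) => t t0; constructor 3.
  rewrite !dotl !dotN ps ss sm (dotC _ (edge e (- s)) (edge e s)).
  have : t * dot M (edge e s) (edge e (- s)) < 0 by rewrite pmulr_rlt0.
  by move=> ?; split; lra.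
Qed.

Lemma compl_eclosure_crooked p s : unit_spacelike M s ->
  ~` eclosure (crooked_halfspace M p s) = crooked_halfspace M p (- s).
Proof.
move=> us; rewrite eclosure_crooked //; apply/seteqP; split => q /=.
  by move/in_crookedN => ?; apply/crooked_halfspaceE => //; exact: unit_spacelikeN.
by move/crooked_halfspaceE => H; apply/in_crookedN/H/unit_spacelikeN.
Qed.

Lemma crooked_subset_halfplane p p' s s' :
  unit_spacelike M s -> unit_spacelike M s' ->
  crooked_halfspace M p s `<=` crooked_halfspace M p' s' ->
  halfplane M s `<=` halfplane M s'.
Proof.
move=> us us' sub; apply: (halfplane_le eM us).
exact: (crooked_subset_dot us us' sub).
Qed.

Lemma linearization_crooked p s : unit_spacelike M s ->
  linearization M (crooked_halfspace M p s) = halfplane M s.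
Proof.
move=> us; pose A := crooked_halfspace M p s.
(* As s is a director of [A], the chosen one is genuine and not the default 0; it may come with
   another vertex [p']. *)
have [us' [p' Ap']] : is_director M A (director M A).
  by apply: (@xgetI _ 0 (is_director M A) s); split=> //; exists p.
by apply/seteqP; split; [apply: (@crooked_subset_halfplane p' p)
  |apply: (@crooked_subset_halfplane p p')] => //; rewrite -Ap'.
Qed.

End Crooked.

Theorem mainTheorem1 (R : realType) (V : vectType R)
    (M : minkowski_structure V) (E : affineSpace V) :
  (* the linearization is a well-defined map: H(p, s) |-> h(s) *)
  (forall (p : E) (s : V), unit_spacelike M s ->
     linearization M (crooked_halfspace M p s) = halfplane M s) /\
  (* (i) *)
  (forall A B : set E,
     is_crooked_halfspace M A -> is_crooked_halfspace M B ->
     A `<=` B -> linearization M A `<=` linearization M B) /\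
  (* (ii) *)
  (forall A : set E, is_crooked_halfspace M A ->
     is_crooked_halfspace M (~` eclosure A) /\
     linearization M (~` eclosure A) = compl_halfplane M (linearization M A)).
Proof.
have [e eM] := adapted_exists M.
split; first by move=> p s; exact: (linearization_crooked eM).
split.
  move=> A B [s [us [p ->]]] [s' [us' [p' ->]]] sub.
  rewrite !(linearization_crooked eM) //.
  exact: (crooked_subset_halfplane eM us us' sub).
move=> A [s [us [p ->]]]; rewrite (compl_eclosure_crooked eM) //.
have usN := unit_spacelikeN us.
split; first by exists (- s); split=> //; exists p.
by rewrite !(linearization_crooked eM) // (compl_halfplaneE eM).
Qed.
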